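(* Let $p\in(1,\infty)$. If $w\in A_p(\mu)$ and $g=\log w$, then $g\in BMO(\mu)$. Conversely, if $f\in BMO(\mu)$, then for $\lambda>0$ small enough there is $w\in A_p(\mu)$ such that $f=\lambda^{-1}\log w$. In other words, $BMO(\mu)=\{\lambda\log w: w\in A_\infty(\mu),\ \lambda\in\mathbb R\}$.
   Context: Tree and flow measure. $T$ is (the vertex set of) an infinite tree, i.e. an infinite connected graph with no loops. $d$ is the geodesic distance and $x\sim y$ means $d(x,y)=1$. $\partial T$ is the boundary of $T$ (equivalence classes of semi-infinite geodesics, two being equivalent if they eventually coincide). Fix $\omega_*\in\partial T$; $[x,\omega_* )$ is the semi-infinite geodesic from $x$ to $\omega_*$, and $x\le y$ means $y\in[x,\omega_* )$. Fix $o\in T$, enumerate $[o,\omega_* )=\{x_j\}_{j\in\mathbb N}$ with $x_0=o$ and $d(x_j,x_k)=|j-k|$, and define the level $\ell(x)=\lim_{j\to\infty}(j-d(x,x_j))$. The set of successors of $x$ is $s(x)=\{y\sim x:\ell(y)=\ell(x)-1\}$. A flow measure is a positive function $\mu$ on $T$ with $\mu(x)=\sum_{y\in s(x)}\mu(y)$ for all $x\in T$; $\mu(E)=\sum_{y\in E}\mu(y)$. Standing assumption: $\mu$ is a flow measure which is locally doubling on $(T,d)$, i.e. for every $r>0$ there is $D_r$ with $\mu(B(x,2r))\le D_r\,\mu(B(x,r))$ for all $x\in T$ (this implies that $T$ has uniformly bounded degree). A weight is a positive function on $T$. Trapezoids. Fix a number $\beta\ge 12$. For $x\in T$ and $h_1,h_2\in\mathbb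 N$, $h_1<h_2$, the trapezoid with root $x$ and heights $h_1,h_2$ is $R_{h_1}^{h_2}(x)=\{y\in T: y\le x,\ h_1\le d(x,y)<h_2\}$. It is admissible if $2\le h_2/h_1\le\beta$ (so $h_1\ge1$). $\mathcal R$ is the family of all admissible trapezoids and all singletons. Weights. For $p\in(1,\infty)$, a weight $w$ is in $A_p(\mu)$ if $$\sup_{R\in\mathcal R}\Big(\frac1{\mu(R)}\sum_{y\in R}w(y)\mu(y)\Big)\Big(\frac1{\mu(R)}\sum_{y\in R}w(y)^{-1/(p-1)}\mu(y)\Big)^{p-1}<\infty.$$ $A_\infty(\mu)=\bigcup_{p>1}A_p(\mu)$. For $f:T\to\mathbb R$ put $f_R=\frac1{\mu(R)}\sum_{y\in R}f(y)\mu(y)$; $BMO(\mu)$ is the set of all $f:T\to\mathbb R$ with $\sup_{R\in\mathcal R}\frac1{\mu(R)}\sum_{y\in R}|f(y)-f_R|\mu(y)<\infty$. *)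

(* Defs.v *)
From HB Require Import structures.
From mathcomp Require Import all_boot all_order all_algebra.
From mathcomp Require Import all_classical all_reals all_analysis.
Set Implicit Arguments.
Unset Strict Implicit.
Unset Printing Implicit Defensive.
Import Order.TTheory GRing.Theory Num.Theory.
Import numFieldNormedType.Exports.
Local Open Scope classical_set_scope.
Local Open Scope ring_scope.

Section Tree.
Variables (T : choiceType) (adj : rel T).

(* A graph is a symmetric irreflexive relation; [ucycle adj c] holds of a
   repetition-free closed walk, which is a genuine cycle when [size c >= 3]
   (each edge gives one of size 2). *)
Definition is_tree : Prop :=
  [/\ symmetric adj, irreflexive adj,
      forall x y, exists p, path adj x p /\ last x p = y
    & forall c, ucycle adj c -> (size c <= 2)%N].

Definition walk_length (x y : T) (n : nat) : Prop :=
  exists p, [/\ path adj x p, last x p = y & size p = n].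

(* The default value 0 is irrelevant when the graph is connected. *)
Definition dist (x y : T) : nat :=
  xget 0%N [set n | walk_length x y n /\
                    forall m, walk_length x y m -> (n <= m)%N].

Definition geodesic_ray (g : nat -> T) : Prop :=
  forall i j : nat, dist (g i) (g j) = `|i%:Z - j%:Z|%N.

Definition eventually_coincide (g g' : nat -> T) : Prop :=
  exists i j : nat, forall n : nat, g (i + n)%N = g' (j + n)%N.

(* Boundary points are equivalence classes of rays, as sets of rays. *)
Definition boundary : set (set (nat -> T)) :=
  [set om | exists2 g, geodesic_ray g &
     om = [set g' | geodesic_ray g' /\ eventually_coincide g g']].

(* The vertex set of [x, om). *)
Definition ray_to (om : set (nat -> T)) (x : T) : set T :=
  [set y | exists g, [/\ om g, g 0%N = x & exists n, g n = y]].

(* x <= y *)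
Definition below (om : set (nat -> T)) (x y : T) : Prop := ray_to om x y.

End Tree.

Section Analysis.
Variables (R : realType) (T : choiceType) (adj : rel T).

(* [xs] is the enumeration of [o, om). *)
Definition level (xs : nat -> T) (x : T) : R :=
  lim ((fun j : nat => j%:R - (dist adj x (xs j))%:R : R) @ \oo).

Definition successors (xs : nat -> T) (x : T) : set T :=
  [set y | dist adj x y = 1%N /\ level xs y = level xs x - 1].

Definition tree_ball (x : T) (r : R) : set T :=
  [set y | (dist adj x y)%:R <= r].

(* mu(E), possibly infinite: finiteness of degrees is not assumed. *)
Definition mass (mu : T -> R) (E : set T) : \bar R :=
  \esum_(y in E) (mu y)%:E.

Definition weight (w : T -> R) : Prop := forall x, 0 < w x.

Definition flow_measure (xs : nat -> T) (mu : T -> R) : Prop :=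
  weight mu /\ forall x, (mu x)%:E = mass mu (successors xs x).

Definition locally_doubling (mu : T -> R) : Prop :=
  forall r : R, 0 < r -> exists D : R, forall x : T,
    (mass mu (tree_ball x (2 * r)) <= D%:E * mass mu (tree_ball x r))%E.

Definition trapezoid (om : set (nat -> T)) (x : T) (h1 h2 : nat) : set T :=
  [set y | below om y x /\ (h1 <= dist adj x y < h2)%N].

Definition admissible (beta : R) (h1 h2 : nat) : Prop :=
  [/\ (0 < h1)%N, (h1 < h2)%N, 2 <= h2%:R / h1%:R :> R & h2%:R / h1%:R <= beta].

Definition trapezoids (beta : R) (om : set (nat -> T)) : set (set T) :=
  [set E | (exists x, E = [set x]) \/
           exists x h1 h2, admissible beta h1 h2 /\ E = trapezoid om x h1 h2].

(* f_E. Only used on members of [trapezoids], which are finite (and nonempty)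
   when mu is a locally doubling flow measure; the finitely supported sum is
   then the sum over E. *)
Definition mean (mu : T -> R) (f : T -> R) (E : set T) : R :=
  (fine (mass mu E))^-1 * \sum_(y \in E) (f y * mu y).

Definition Ap (beta : R) (om : set (nat -> T)) (mu : T -> R) (p : R) :
    set (T -> R) :=
  [set w | weight w /\
    (ereal_sup [set (mean mu w E *
                     mean mu (fun y => w y `^ (- (p - 1)^-1)) E `^ (p - 1))%:E
               | E in trapezoids beta om] < +oo)%E].

Definition Ainfty (beta : R) (om : set (nat -> T)) (mu : T -> R) :
    set (T -> R) :=
  \bigcup_(p in [set p : R | 1 < p]) Ap beta om mu p.

Definition BMO (beta : R) (om : set (nat -> T)) (mu : T -> R) :
    set (T -> R) :=
  [set f | (ereal_sup [set (mean mu (fun y => `|f y - mean mu f E|) E)%:E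
                      | E in trapezoids beta om] < +oo)%E].

End Analysis.

(* Main.v *)
Require Import Defs.
From HB Require Import structures.
From mathcomp Require Import all_boot all_order all_algebra.
From mathcomp Require Import all_classical all_reals all_analysis.
From mathcomp Require Import finmap.
From mathcomp Require Import zify ring lra.
Set Implicit Arguments.
Unset Strict Implicit.
Unset Printing Implicit Defensive.
Import Order.TTheory GRing.Theory Num.Theory.
Import numFieldNormedType.Exports.
Local Open Scope classical_set_scope.
Local Open Scope ring_scope.

(** A function [g] has bounded mean oscillation as soon as [expR g] is an A_p
weight, because the two factors of the A_p product, once [g] is centred at its
mean, are averages of [expR t] and [expR (- t / (p - 1))] with [t] of mean zero.
By Jensen both are at least 1, so a bound on the product bounds each factor,
and together they dominate the average of [`|t|] ([oscillation_le]).

The converse is a John-Nirenberg inequality: the averages of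
[expR (lambda * `|f - f_E|)] are bounded uniformly in the admissible trapezoids
[E] when [lambda] is small. The geometric input is that an admissible trapezoid
can be cut into admissible trapezoids, or into points, each carrying at least a
fixed fraction of its mass ([ranked_split]). When [h1 = 1] the heights are
bounded and the trapezoid is cut into points. Otherwise a tall trapezoid, with
[h2 >= 4 * h1], is cut at height [2 * h1], and a flat one is cut into the
trapezoids with heights [h1 - 1], [h2 - 1] below the successors of its root.
Repeating the cut ends after finitely many steps, so trapezoids play the role of dyadic cubes.

With such cuts the John-Nirenberg inequality follows from the stopping time
argument of Calderon and Zygmund. Starting from [E], the cutting stops at the
pieces on which [f] is on average farther than [2 * K] from its mean on [E],
where [K] bounds the oscillation. These pieces occupy at most half of [E], and
the mean of [f] on each of them differs from its mean on [E] by at most a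
constant, since the piece is a fixed fraction of a piece at which the cutting
did not stop. The exponential bound on [E] then follows from the same bound on
the smaller pieces. Here this is an induction on a rank that decreases with
each cut ([jn_stopping], [john_nirenberg]), in which the stopped pieces never
have to be collected.

The order structure of the tree reduces to one map, sending each vertex to its
neighbour in the direction of the chosen boundary point ([parent_map]): [y] lies
below [x] exactly when [x] is an iterate of that map at [y], and the successors
of [x] form the fibre over [x]. Both facts rest on the observation that, in a
tree, a vertex has at most one neighbour that is no farther from a given point
than the vertex itself ([closer_unique]). The flow equation then gives every
generation below [x] the mass [mu x], hence the trapezoid with heights [h1],
[h2] below [x] the mass [(h2 - h1) * mu x]. *)

(** * Distance in a tree *)

Section TreeDistance.
Local Open Scope nat_scope.
Variables (T : choiceType) (adj : rel T).
Hypothesis tree_adj : is_tree adj.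
Local Notation d := (dist adj).

Let adjC : symmetric adj. Proof. by case: tree_adj. Qed.
Let adjxx : irreflexive adj. Proof. by case: tree_adj. Qed.

Lemma dist_spec x y : walk_length adj x y (d x y) /\
  forall m, walk_length adj x y m -> d x y <= m.
Proof.
have ex : exists n, `[< walk_length adj x y n >].
  case: tree_adj => _ _ /(_ x y)[p [pP lp]] _.
  by exists (size p); apply/asboolP; exists p.
have [n /asboolP wn nmin] := ex_minnP ex.
apply: (@xgetPex _ 0 [set n | walk_length adj x y n /\
                    forall m, walk_length adj x y m -> (n <= m)]).
by exists n; split=> // m wm; apply: nmin; apply/asboolP.
Qed.

Lemma dist_walk x y : walk_length adj x y (d x y).
Proof. by have [] := dist_spec x y. Qed.

Lemma dist_le x y m : walk_length adj x y m -> d x y <= m.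
Proof. by have [_] := dist_spec x y; apply. Qed.

Lemma distxx x : d x x = 0.
Proof. by apply/eqP; rewrite -leqn0; apply: dist_le; exists [::]. Qed.

Lemma dist_eq0 x y : d x y = 0 -> x = y.
Proof. by move=> d0; have := dist_walk x y; rewrite d0 => -[[|? ?] []]. Qed.

Lemma distC x y : d x y = d y x.
Proof.
suff le a b : d a b <= d b a by apply/eqP; rewrite eqn_leq !le.
have [p [pP pl <-]] := dist_walk b a; apply: dist_le.
exists (rev (belast b p)); split; last by rewrite size_rev size_belast.
  by rewrite -pl rev_path; apply: sub_path pP => u v; rewrite adjC.
by case: p pl {pP} => //= c p _; rewrite rev_cons last_rcons.
Qed.

Lemma dist_triangle y x z : d x z <= d x y + d y z.
Proof.
have [p [pP pl <-]] := dist_walk x y; have [q [qP ql <-]] := dist_walk y z.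
apply: dist_le; exists (p ++ q); rewrite cat_path last_cat pl pP qP ql.
by rewrite size_cat.
Qed.

Lemma dist_adj x y : adj x y -> d x y = 1.
Proof.
move=> xy; apply/eqP; rewrite eqn_leq dist_le ?lt0n /=; last first.
  by exists [:: y]; rewrite /= xy.
by apply/eqP => /dist_eq0 e; rewrite e adjxx in xy.
Qed.

Lemma adj_dist1 x y : d x y = 1 -> adj x y.
Proof.
move=> d1; have := dist_walk x y; rewrite d1 => -[[|a [|? ?]] [] //=].
by rewrite andbT => + <-.
Qed.

Lemma closer_neighbour x z : x <> z ->
  exists2 y, adj x y & d x z = (d y z).+1.
Proof.
move=> xz; have [[|y p] [/= pP pl sp]] := dist_walk x z; first by case: xz.
move/andP: pP => [xy yp]; exists y => //; apply/eqP; rewrite eqn_leq.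
have -> : d x z <= (d y z).+1.
  by rewrite -add1n -(dist_adj xy) dist_triangle.
by rewrite -sp /= ltnS; apply: dist_le; exists p.
Qed.

(** Otherwise [x] followed by a simple path from [y] to [y'] would be a cycle. *)
Lemma neighbour_unique x y y' p : adj x y -> adj x y' ->
  path adj y p -> last y p = y' -> x \notin y :: p -> y = y'.
Proof.
move=> xy xy' /shortenP[q qP uq qsub] lq xn.
have xq : x \notin y :: q.
  move: xn; rewrite !inE !negb_or => /andP[-> xp] /=.
  by apply: contra xp; apply: qsub.
case: tree_adj => _ _ _ /(_ (x :: y :: q)); apply: contraPP => yy'.
have q0 : 0 < size q by case: q lq {qP uq qsub xq} => //= /yy'.
move=> small; have : (size (x :: y :: q) <= 2)%N.
  apply: small; apply/andP; split; last by rewrite cons_uniq xq uq.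
  by rewrite (cycle_path x) /= lq adjC xy' xy qP.
by rewrite /= !ltnS leqn0 => /eqP s0; rewrite s0 in q0.
Qed.

(** The vertices of a geodesic from [y] to [z], except [y], are closer to [z] than
[y] is. *)
Lemma geodesic_avoid x y z : y <> x -> d y z <= d x z ->
  exists p, [/\ path adj y p, last y p = z & x \notin y :: p].
Proof.
move=> yx le; have [p [pP pl sp]] := dist_walk y z.
exists p; split=> //; rewrite inE negb_or; apply/andP; split.
  by apply/eqP => e; apply: yx.
apply/negP => /splitPr; move: pP pl sp => + + + E.
case: E => p1 p2; rewrite cat_path last_cat /= => /and3P[_ _ p2P] p2l s.
move: le; rewrite leqNgt => /negP; apply.
have : d x z <= size p2 by apply: dist_le; exists p2.
by move/leq_ltn_trans; apply; rewrite -s size_cat /= addnS ltnS leq_addl.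
Qed.

(** Going from [y] to [z] and back to [y'] along geodesics avoids [x]. *)
Lemma closer_unique x y y' z : adj x y -> adj x y' ->
  d y z <= d x z -> d y' z <= d x z -> y = y'.
Proof.
move=> xy xy' le le'.
have nx u : adj x u -> u <> x by move=> /[swap] ->; rewrite adjxx.
have [p [pP pl xp]] := geodesic_avoid (nx _ xy) le.
have [q [qP ql xq]] := geodesic_avoid (nx _ xy') le'.
apply: (@neighbour_unique x _ _ (p ++ rev (belast y' q))) => //.
- rewrite cat_path pP pl -ql rev_path /=.
  by apply: sub_path qP => u v; rewrite adjC.
- by rewrite last_cat pl; case: (q) ql => //= c r _; rewrite rev_cons last_rcons.
- rewrite -cat_cons mem_cat negb_or xp mem_rev /=.
  by apply: contra xq => /mem_belast.
Qed.

Lemma farther_neighbour x y y' z : adj x y -> adj x y' -> y <> y' ->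
  d y z <= d x z -> d y' z = (d x z).+1.
Proof.
move=> xy xy' yy' le; apply/eqP; rewrite eqn_leq; apply/andP; split.
  by rewrite -add1n -(dist_adj xy') (distC x) dist_triangle.
by rewrite ltnNge; apply/negP => le'; apply/yy'/(closer_unique xy xy' le le').
Qed.

End TreeDistance.

(** * Orientation towards a boundary point *)

Section Parent.
Local Open Scope nat_scope.
Variables (T : choiceType) (adj : rel T).
Hypothesis tree_adj : is_tree adj.
Variables (om : set (nat -> T)) (xs : nat -> T).
Hypotheses (om_bd : boundary adj om) (xs_om : om xs).
Local Notation d := (dist adj).

Lemma boundary_class g :
  om g <-> geodesic_ray adj g /\ eventually_coincide xs g.
Proof.
have [g0 g0g omE] := om_bd; move: xs_om; rewrite omE /=.
move=> [xsg [i [j E]]]; split=> -[gg [k [l F]]]; split=> //.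
- exists (j + k); exists (i + l) => n.
  have -> : j + k + n = j + (k + n) by lia.
  by rewrite -E addnCA F; congr g; lia.
- exists (i + k); exists (l + j) => n.
  by rewrite -addnA E addnCA F addnA.
Qed.

Lemma dist_ray i j : i <= j -> d (xs i) (xs j) = j - i.
Proof.
by move=> ij; have [xsg _] := (boundary_class xs).1 xs_om; rewrite xsg; lia.
Qed.

Definition escapes J x :=
  forall j, J <= j -> d x (xs j) = d x (xs J) + (j - J).

(** The natural number [d x (xs j) + d x (xs 0) - j] is nonincreasing in [j], hence
eventually constant; this is also why the limit defining the level exists. *)
Lemma escapesP x : exists J, escapes J x.
Proof.
pose u j := d x (xs j) + d x (xs 0) - j.
have lb j : j <= d x (xs j) + d x (xs 0).
  have := dist_ray (leq0n j); have := dist_triangle tree_adj x (xs 0) (xs j).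
  by have := distC tree_adj x (xs 0); lia.
have mono i j : i <= j -> u j <= u i.
  move=> ij; have := dist_triangle tree_adj (xs i) x (xs j).
  have := lb i; have := lb j; have := dist_ray ij; rewrite /u; lia.
have ex : exists n, `[< exists j, u j = n >].
  by exists (u 0); apply/asboolP; exists 0.
have [n /asboolP[J uJ] nmin] := ex_minnP ex.
exists J => j Jj; have : n <= u j by apply: nmin; apply/asboolP; exists j.
have := mono _ _ Jj; rewrite -uJ.
by have := lb j; have := lb J; rewrite /u; lia.
Qed.

Lemma escapes_le J J' x : J <= J' -> escapes J x -> escapes J' x.
Proof.
move=> le e j lj; rewrite (e j) ?(leq_trans le) // (e J') //; lia.
Qed.

Definition towards x y :=
  adj x y /\ exists J, forall j, J <= j -> d x (xs j) = (d y (xs j)).+1.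

(** A neighbour that is closer to one point of the ray, taken far enough, is
closer to all later points by the triangle inequality. *)
Lemma escapes_towards J x y : escapes J x -> adj x y ->
  d x (xs J) = (d y (xs J)).+1 -> towards x y /\ escapes J y.
Proof.
move=> ex xy E.
have K j : J <= j -> d x (xs j) = (d y (xs j)).+1.
  move=> Jj; have := dist_triangle tree_adj (xs J) y (xs j).
  have := dist_triangle tree_adj y x (xs j).
  by have := dist_adj tree_adj xy; have := dist_ray Jj; have := ex j Jj;
    move: E; lia.
split; first by split=> //; exists J.
by move=> j Jj; have := K j Jj; have := ex j Jj; lia.
Qed.

Lemma towards_exists x : exists y, towards x y.
Proof.
have [J eJ] := escapesP x; have eJ1 := escapes_le (leqnSn J) eJ.
have xJ : x <> xs J.+1.
  by move=> e; have := eJ J.+1 (leqnSn J); rewrite -e (distxx tree_adj); lia.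
have [y xy E] := closer_neighbour tree_adj xJ; exists y.
by have [] := escapes_towards eJ1 xy E.
Qed.

Lemma towards_unique x y y' : towards x y -> towards x y' -> y = y'.
Proof.
move=> [xy [J E]] [xy' [J' E']].
apply: (closer_unique tree_adj (z := xs (maxn J J')) xy xy').
  by rewrite E ?leq_maxl.
by rewrite E' ?leq_maxr.
Qed.

Lemma towards_adj x y : adj x y -> towards x y \/ towards y x.
Proof.
move=> xy; have [z [xz [J E]]] := towards_exists x.
have [->|yz] := pselect (y = z); first by left; split=> //; exists J.
right; split; first by have [adjC _ _ _] := tree_adj; rewrite adjC.
exists J => j Jj; apply: (farther_neighbour tree_adj xz xy) => [/esym //|].
by rewrite E.
Qed.

(** A ray in the class of [xs] always steps towards the boundary point, because
it eventually runs along [xs]. *)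
Lemma ray_towards g n : om g -> towards (g n) (g n.+1).
Proof.
move=> /boundary_class[gg [i [j E]]].
have dg a b : a <= b -> d (g a) (g b) = b - a by move=> ab; rewrite gg; lia.
split; first by apply: adj_dist1 => //; have := dg n n.+1 (leqnSn n); lia.
exists (i + n.+1) => k lk.
have -> : k = i + (k - i) by lia.
by rewrite E !dg; lia.
Qed.

Definition parent (x : T) : T := projT1 (cid (towards_exists x)).

Lemma parentP x : towards x (parent x).
Proof. by rewrite /parent; case: cid. Qed.

Lemma parent_eq x y : towards x y -> parent x = y.
Proof. exact/towards_unique/parentP. Qed.

Lemma iter_parent_dist n y :
  exists J, forall j, J <= j -> d y (xs j) = d (iter n parent y) (xs j) + n.
Proof.
elim: n => [|n [J IH]]; first by exists 0 => j _; rewrite addn0.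
have [_ [J' E]] := parentP (iter n parent y).
exists (maxn J J') => j; rewrite geq_max => /andP[Jj J'j].
by rewrite IH // E // addnS.
Qed.

Lemma parent_ray y : geodesic_ray adj (fun n => iter n parent y).
Proof.
suff H i j : i <= j -> d (iter i parent y) (iter j parent y) = j - i.
  move=> i j; case/orP: (leq_total i j) => ij; last rewrite distC //.
    by have := H _ _ ij; lia.
  by have := H _ _ ij; lia.
move=> ij; rewrite -(subnK ij) iterD addnK.
move: (j - i) (iter i parent y) => {ij i j} n z.
apply/eqP; rewrite eqn_leq; apply/andP; split.
  elim: n => [|n IH]; first by rewrite (distxx tree_adj).
  have := dist_triangle tree_adj (iter n parent z) z (iter n.+1 parent z).
  have [a _] := parentP (iter n parent z).
  by have := dist_adj tree_adj a; move: IH => /=; lia.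
have [J /(_ J (leqnn J))] := iter_parent_dist n z.
by have := dist_triangle tree_adj (iter n parent z) z (xs J); lia.
Qed.

(** By induction on the distance from [y] to a point [xs J] far along the ray: each
step towards the boundary point is a step towards [xs J]. *)
Lemma parent_xs y : exists n m, iter n parent y = xs m.
Proof.
have [J eJ] := escapesP y; move: {2}(d y (xs J)) (erefl (d y (xs J))) => n.
elim: n y eJ => [|n IH] y eJ dn; first by exists 0; exists J; exact: (dist_eq0 tree_adj dn).
have yJ : y <> xs J by move=> e; move: dn; rewrite e (distxx tree_adj).
have [z yz E] := closer_neighbour tree_adj yJ.
have [tz ez] := escapes_towards eJ yz E.
have [|k [m km]] := IH z ez; first by move: E dn; lia.
by exists k.+1; exists m; rewrite iterSr (parent_eq tz).
Qed.

Lemma om_parent y : om (fun n => iter n parent y).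
Proof.
apply/boundary_class; split; first exact: parent_ray.
have [n [m E]] := parent_xs y; exists m; exists n => k.
rewrite (addnC n) iterD E; elim: k => [|k IH]; first by rewrite addn0.
by rewrite addnS iterS -IH; apply/esym/parent_eq/ray_towards.
Qed.

Lemma below_iter y x n : below om y x /\ d x y = n <-> iter n parent y = x.
Proof.
have dp k : d y (iter k parent y) = k.
  by have := parent_ray y 0 k; rewrite /=; lia.
split=> [[[g [gom g0 [m gm]]] dn]|<-]; last first.
  split; last by rewrite distC // dp.
  by exists (fun k => iter k parent y); split; [exact: om_parent| |exists n].
have gE k : g k = iter k parent y.
  by elim: k => [//|k IH]; rewrite iterS -IH; apply/esym/parent_eq/ray_towards.
by rewrite -gm gE; congr iter; rewrite -dn -gm gE distC // dp.
Qed.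

Lemma parentE x y : parent y = x <-> towards y x.
Proof. by split=> [<-|]; [exact: parentP|exact: parent_eq]. Qed.

Lemma level_escapes (R : realType) J x : escapes J x ->
  level R adj xs x = (J%:R - (d x (xs J))%:R :> R)%R.
Proof.
move=> eJ; apply: (@cvg_lim R^o) => //; apply: cvg_near_cst.
near=> j; have Jj : J <= j by near: j; exact: nbhs_infty_ge.
rewrite (eJ j Jj) natrD natrB //; lra.
Unshelve. all: by end_near. Qed.

Lemma level_towards (R : realType) x y : towards x y ->
  level R adj xs y = (level R adj xs x + 1 :> R)%R.
Proof.
move=> [xy [J E]]; have [Jx ex] := escapesP x; have [Jy ey] := escapesP y.
pose K := maxn J (maxn Jx Jy).
have eKx : escapes K x by apply: escapes_le ex; lia.
have eKy : escapes K y by apply: escapes_le ey; lia.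
rewrite (level_escapes R eKx) (level_escapes R eKy) (E K) ?leq_maxl //.
rewrite -addn1 natrD; lra.
Qed.

Lemma successorsE (R : realType) x : successors R adj xs x = [set y | parent y = x].
Proof.
apply/seteqP; split=> y /=.
  move=> [/(adj_dist1 tree_adj) xy ly]; apply/parentE.
  case: (towards_adj xy) => // /(level_towards R); rewrite ly; lra.
move=> /parentE yx; have [a _] := yx; split.
  by rewrite distC //; exact: dist_adj.
rewrite (level_towards R yx); lra.
Qed.

End Parent.

(** The choice of a boundary point orients the tree: order, distance along the
order and successors are all read off from the map [pi]. *)
Theorem parent_map (R : realType) (T : choiceType) (adj : rel T)
    (om : set (nat -> T)) (xs : nat -> T) :
  is_tree adj -> boundary adj om -> om xs -> exists pi : T -> T,
  [/\ forall y x n, below om y x /\ dist adj x y = n <-> iter n pi y = x,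
      forall x, successors R adj xs x = [set y | pi y = x]
    & forall x, adj x (pi x)].
Proof.
move=> tr bd xsom; exists (parent tr bd xsom); split.
- exact: below_iter.
- exact: successorsE.
- by move=> x; case: (parentP tr bd xsom x).
Qed.

(** * Partitions and finite weighted sums *)

Definition partition_by (T : choiceType) (I : finType) (F : I -> set T)
    (E : set T) : Prop :=
  E = \bigcup_i F i /\ trivIset setT F.

Section WeightedSum.
Variables (R : realType) (T : choiceType).
Implicit Types (mu f g : T -> R) (E : set T).

Definition wsum mu E f : R := \sum_(y <- fset_set E) f y * mu y.

Definition vol mu E : R := \sum_(y <- fset_set E) mu y.

Lemma wsum_cst mu E a : wsum mu E (fun=> a) = a * vol mu E.
Proof. by rewrite /wsum -mulr_sumr. Qed.

Lemma wsumZ mu E a f : wsum mu E (fun y => a * f y) = a * wsum mu E f.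
Proof. by rewrite /wsum mulr_sumr; apply: eq_bigr => y _; rewrite mulrA. Qed.

Lemma wsumD mu E f g : wsum mu E (fun y => f y + g y) = wsum mu E f + wsum mu E g.
Proof. by rewrite /wsum -big_split /=; apply: eq_bigr => y _; rewrite mulrDl. Qed.

Lemma wsumB mu E f g : wsum mu E (fun y => f y - g y) = wsum mu E f - wsum mu E g.
Proof. by rewrite /wsum -sumrB; apply: eq_bigr => y _; rewrite mulrBl. Qed.

Lemma le_wsum mu E f g : weight mu -> (forall y, f y <= g y) ->
  wsum mu E f <= wsum mu E g.
Proof. by move=> mu0 fg; apply: ler_sum => y _; rewrite ler_wpM2r // ltW ?mu0. Qed.

Lemma wsum_ge0 mu E f : weight mu -> (forall y, 0 <= f y) -> 0 <= wsum mu E f.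
Proof. by move=> mu0 f0; apply: sumr_ge0 => y _; rewrite mulr_ge0 // ltW ?mu0. Qed.

Lemma vol_gt0 mu E : weight mu -> finite_set E -> E !=set0 -> 0 < vol mu E.
Proof.
move=> mu0 finE [x Ex]; rewrite /vol (big_fsetD1 x) /=; last first.
  by rewrite in_fset_set ?mem_set.
by rewrite ltr_wpDr ?mu0 // sumr_ge0 // => y _; rewrite ltW ?mu0.
Qed.

Lemma wsum1 mu x f : wsum mu [set x] f = f x * mu x.
Proof. by rewrite /wsum fset_set1 big_seq_fset1. Qed.

Lemma vol1 mu x : vol mu [set x] = mu x.
Proof. by rewrite /vol fset_set1 big_seq_fset1. Qed.

Lemma sum_partition (I : finType) (F : I -> set T) E f :
  finite_set E -> partition_by F E ->
  \sum_(y <- fset_set E) f y = \sum_i \sum_(y <- fset_set (F i)) f y.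
Proof.
move=> finE [EF tF].
have finF i : finite_set (F i).
  by apply: sub_finite_set finE; rewrite EF; exact: bigcup_sup.
have FE i : \sum_(y <- fset_set (F i)) f y =
    \sum_(y <- fset_set E) (if y \in F i then f y else 0).
  rewrite -big_mkcond /= [RHS]big_fset_condE /=; apply: eq_fbigl => y.
  rewrite in_fset_set // in_fsetE /= inE /= in_fset_set //.
  apply/idP/andP => [Fiy|[] //]; split=> //; apply: mem_set.
  by rewrite EF; exists i => //; exact: set_mem.
rewrite (eq_bigr _ (fun i _ => FE i)) exchange_big /=.
rewrite big_seq [RHS]big_seq; apply: eq_bigr => y.
rewrite in_fset_set // => /set_mem; rewrite EF => -[i _ Fiy].
rewrite (bigD1 i) //= mem_set // big1 ?addr0 // => j ji.
case: ifPn => // /set_mem Fjy; case/eqP: ji.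
by apply: tF => //; exists y.
Qed.

Lemma wsum_partition (I : finType) (F : I -> set T) mu E f :
  finite_set E -> partition_by F E ->
  wsum mu E f = \sum_i wsum mu (F i) f.
Proof. exact: sum_partition. Qed.

Lemma vol_partition (I : finType) (F : I -> set T) mu E :
  finite_set E -> partition_by F E ->
  vol mu E = \sum_i vol mu (F i).
Proof. exact: sum_partition. Qed.

Lemma massE mu E : weight mu -> finite_set E -> fine (mass mu E) = vol mu E.
Proof.
move=> mu0 finE; rewrite /mass esum_fset //; last by move=> i _; rewrite lee_fin ltW ?mu0.
by rewrite fsbig_finite //= sumEFin.
Qed.

Lemma meanE mu f E : weight mu -> finite_set E ->
  mean mu f E = (vol mu E)^-1 * wsum mu E f.
Proof. by move=> mu0 finE; rewrite /mean massE // fsbig_finite. Qed.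

End WeightedSum.

(** * The John-Nirenberg inequality for a family stable under cutting *)

Section JohnNirenberg.
Variables (R : realType) (T : choiceType) (mu : T -> R).
Hypothesis mu_gt0 : weight mu.
(* The index of a member of the family is the rank along which the cutting
   terminates. *)
Variables (fam : nat -> set (set T)) (c : R).
Hypothesis c01 : 0 < c <= 1.
Hypothesis fam_fin : forall n E, fam n E -> finite_set E /\ E !=set0.
Hypothesis fam_split : forall n E, fam n E -> (exists x, E = [set x]) \/
  exists (I : finType) (F : I -> set T),
    [/\ partition_by F E,
        forall i, exists2 m, (m < n)%N & fam m (F i)
      & forall i, c * vol mu E <= vol mu (F i)].
Variables (f : T -> R) (K : R).
Hypothesis K_gt0 : 0 < K.
Hypothesis f_bmo : forall n E, fam n E ->
  wsum mu E (fun y => `|f y - mean mu f E|) <= K * vol mu E.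

(** Chosen so that moving the centre of oscillation by [2 * K / c], the largest
jump of the mean at a stopped piece, costs a factor [3 / 2]. *)
Definition jn_exponent : R := ln (3 / 2) / (2 * K / c).
Local Notation lam := jn_exponent.

Lemma jn_exponent_gt0 : 0 < lam.
Proof.
case/andP: c01 => c0 _; rewrite divr_gt0 ?ln_gt0 ?divr_gt0 ?mulr_gt0 //; lra.
Qed.

Let expM : expR (lam * (2 * K / c)) = 3 / 2.
Proof.
case/andP: c01 => c0 _; rewrite /lam divfK ?lnK ?posrE //.
by rewrite gt_eqF // divr_gt0 ?mulr_gt0.
Qed.

Lemma mean_shift E a : finite_set E -> E !=set0 ->
  `|mean mu f E - a| * vol mu E <= wsum mu E (fun y => `|f y - a|).
Proof.
move=> finE E0; have v0 := vol_gt0 mu_gt0 finE E0.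
rewrite -[X in _ * X]gtr0_norm // -normrM meanE // mulrBl mulrAC mulVf ?gt_eqF //.
rewrite mul1r -wsum_cst -wsumB /wsum.
apply: le_trans (ler_norm_sum _ _ _) _; apply: ler_sum => y _.
by rewrite normrM (gtr0_norm (mu_gt0 y)).
Qed.

(** The stopping time argument, for pieces [G] at which the cutting has not
stopped. The first term on the right accounts for the points that are never in
a stopped piece; on a stopped piece [F] the induction hypothesis and the shift of
the mean give [3 / 2 * 6 * vol mu F], which Chebyshev's inequality turns into
the second term. That term is additive in [G], which is what makes the induction
on the rank of [G] close. *)
Lemma jn_stopping n a k G : (k <= n)%N -> fam k G ->
  (forall m E, (m < n)%N -> fam m E ->
    wsum mu E (fun y => expR (lam * `|f y - mean mu f E|)) <= 6 * vol mu E) ->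
  wsum mu G (fun y => `|f y - a|) <= 2 * K * vol mu G ->
  wsum mu G (fun y => expR (lam * `|f y - a|)) <=
    3 / 2 * vol mu G + 9 / (2 * K) * wsum mu G (fun y => `|f y - a|).
Proof.
move=> kn famG IHn; case/andP: c01 => c0 c1.
have l0 := jn_exponent_gt0.
elim/ltn_ind: k G kn famG => k IHk G kn famG Ga.
have [finG G0] := fam_fin famG.
case: (fam_split famG) => [[x Gx]|[I [F [pF Fk Fc]]]].
  move: Ga; rewrite Gx !wsum1 vol1 ler_pM2r ?mu_gt0 // => Ga.
  apply: (@le_trans _ _ (3 / 2 * mu x)); last first.
    rewrite lerDl; apply: mulr_ge0; last by rewrite mulr_ge0 // ltW.
    by rewrite divr_ge0 // mulr_ge0 // ltW.
  rewrite ler_pM2r ?mu_gt0 // -expM ler_expR ler_pM2l // (le_trans Ga) //.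
  by rewrite ler_pdivlMr // ler_piMr // mulr_ge0 // ltW.
rewrite !(wsum_partition mu _ finG pF) (vol_partition mu finG pF).
rewrite !mulr_sumr -big_split /=; apply: ler_sum => i _.
have [m mk famF] := Fk i.
have [finF F0] := fam_fin famF.
have vF := vol_gt0 mu_gt0 finF F0.
have [small|/ltW large] := leP (wsum mu (F i) (fun y => `|f y - a|)) (2 * K * vol mu (F i)).
  by apply: (IHk m) => //; lia.
have Fa : wsum mu (F i) (fun y => `|f y - a|) <= 2 * K / c * vol mu (F i).
  apply: (@le_trans _ _ (wsum mu G (fun y => `|f y - a|))).
    rewrite (wsum_partition mu _ finG pF) (bigD1 i) //= lerDl.
    by apply: sumr_ge0 => j _; apply: wsum_ge0.
  apply: le_trans Ga _; rewrite -!mulrA ler_pM2l // ler_pM2l //.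
  by rewrite ler_pdivlMl.
have shift : `|mean mu f (F i) - a| <= 2 * K / c.
  by rewrite -(ler_pM2r vF); apply: le_trans (mean_shift _ _ _) Fa.
apply: (@le_trans _ _ (3 / 2 * (6 * vol mu (F i)))).
  rewrite -expM; apply: le_trans (ler_wpM2l (expR_ge0 _) (IHn m _ _ famF)); last by lia.
  rewrite -wsumZ; apply: le_wsum => // y; rewrite -expRD ler_expR -mulrDr.
  rewrite ler_pM2l // (le_trans (ler_distD (mean mu f (F i)) _ _)) //.
  by rewrite addrC lerD2r.
apply: (@le_trans _ _ (9 / (2 * K) * (2 * K * vol mu (F i)))).
  by rewrite le_eqVlt; apply/orP; left; apply/eqP; field; rewrite gt_eqF.
apply: le_trans (_ : 9 / (2 * K) * wsum mu (F i) (fun y => `|f y - a|) <= _).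
  by rewrite ler_pM2l // divr_gt0 ?mulr_gt0.
by rewrite lerDr mulr_ge0 ?ltW.
Qed.

(** The constant 6 is the solution of [C = 3 / 2 + 3 / 2 * C / 2]: the stopped
pieces carry at most half of the mass of [E]. *)
Theorem john_nirenberg n E : fam n E ->
  wsum mu E (fun y => expR (lam * `|f y - mean mu f E|)) <= 6 * vol mu E.
Proof.
elim/ltn_ind: n E => n IH E famE.
have [finE E0] := fam_fin famE; have v0 := vol_gt0 mu_gt0 finE E0.
have b := f_bmo famE.
have le2 : K * vol mu E <= 2 * K * vol mu E.
  by rewrite ler_pM2r // ler_peMl ?ler1n // ltW.
apply: le_trans (jn_stopping (leqnn n) famE _ (le_trans b le2)) _.
  by move=> m G mn; exact: IH.
have : 9 / (2 * K) * wsum mu E (fun y => `|f y - mean mu f E|) <= 9 / 2 * vol mu E.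
  apply: le_trans (ler_wpM2l _ b) _; first by rewrite divr_ge0 ?mulr_ge0 ?ltW.
  by rewrite le_eqVlt; apply/orP; left; apply/eqP; field; rewrite gt_eqF.
lra.
Qed.

End JohnNirenberg.

(** * Cutting trapezoids into trapezoids *)

Lemma partition_by_singletons (T : choiceType) (E : set T) : finite_set E ->
  partition_by (fun z : fset_set E => [set val z]) E.
Proof.
move=> finE; split.
  apply/seteqP; split=> [y Ey|y [z _ ->]]; last first.
    by apply/set_mem; rewrite -in_fset_set // fsvalP.
  have yE : y \in fset_set E by rewrite in_fset_set ?mem_set.
  by exists [` yE]%fset.
by move=> z z' _ _ [y [-> e]]; apply: val_inj.
Qed.

Lemma admissibleP (R : realType) (beta : R) (h1 h2 : nat) :
  admissible beta h1 h2 <->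
  [/\ (0 < h1)%N, (2 * h1 <= h2)%N & h2%:R <= beta * h1%:R].
Proof.
split=> [[h0 _]|[h0 h12 hb]].
  rewrite ler_pdivlMr ?ltr0n // ler_pdivrMr ?ltr0n // => h12 hb; split=> //.
  by rewrite -(ler_nat R) natrM.
split; rewrite ?ler_pdivlMr ?ler_pdivrMr ?ltr0n //; first by lia.
by rewrite -natrM ler_nat.
Qed.

(** Doubling from radius 1/2 to radius 1, that is from a point to its closed
neighbourhood. *)
Lemma neighbour_comparable (R : realType) (T : choiceType) (adj : rel T)
    (mu : T -> R) :
  is_tree adj -> weight mu -> locally_doubling adj mu ->
  exists2 D : R, 1 <= D & forall x y, adj x y -> mu y <= D * mu x.
Proof.
move=> tr mu0 dbl; have [|D HD] := dbl (2^-1); first by rewrite invr_gt0.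
exists (Num.max 1 D) => [|x y /(dist_adj tr) xy]; first by rewrite le_max lexx.
have := HD x; rewrite mulfV ?pnatr_eq0 //.
have -> : tree_ball adj x (2^-1 : R) = [set x].
  apply/seteqP; split=> z; rewrite /tree_ball /=; [move=> h|move=> ->].
    apply/esym/(dist_eq0 tr); case: (dist adj x z) h => // n.
    by rewrite -natr1 => h; exfalso; have := ler0n R n; lra.
  by rewrite (distxx tr) invr_ge0.
rewrite /mass esum_set1 ?lee_fin ?(ltW (mu0 x)) // -EFinM => le.
have : ((mu y)%:E <= (D * mu x)%:E)%E.
  apply: le_trans le; apply: esum_ge; exists [set y].
    by split=> // z ->; rewrite /tree_ball /= xy.
  by rewrite fsbig_set1.
rewrite lee_fin => /le_trans; apply.
by rewrite ler_wpM2r ?(ltW (mu0 x)) // le_max lexx orbT.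
Qed.

Section Trapezoids.
Variables (R : realType) (T : choiceType) (pi : T -> T) (mu : T -> R).
Hypothesis pi_free : forall y n m, iter n pi y = iter m pi y -> n = m.
Hypothesis mu_gt0 : weight mu.
Let children x := [set y | pi y = x].
Hypothesis mu_flow : forall x, (mu x)%:E = mass mu (children x).
Variable D : R.
Hypothesis D_ge1 : 1 <= D.
Hypothesis mu_pi : forall y, mu (pi y) <= D * mu y.

Let D_gt0 : 0 < D. Proof. exact: lt_le_trans D_ge1. Qed.

(** Each successor of [x] carries at least the fraction [1 / D] of the finite
mass [mu x], so there are at most [D] of them. *)
Lemma finite_children x : finite_set (children x).
Proof.
apply: contrapT => /infinite_set_fset H.
pose N := (Num.truncn D).+1.
have [X XS XN] := H N.
have : (\sum_(y \in [set` X]) (mu y)%:E <= (mu x)%:E)%E.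
  by rewrite mu_flow; apply: esum_ge; exists [set` X].
rewrite fsbig_finite //= set_fsetK sumEFin lee_fin leNgt => /negP; apply.
apply: (@lt_le_trans _ _ (\sum_(y <- X) mu x / D)); last first.
  rewrite big_seq [leRHS]big_seq; apply: ler_sum => y yX.
  by rewrite ler_pdivrMr // mulrC -(XS y yX).
rewrite big_const_seq count_predT iter_addr_0 -[ltRHS]mulr_natr.
rewrite mulrAC ltr_pdivlMr // ltr_pM2l // (lt_le_trans (truncnS_gt _)) //.
by rewrite ler_nat.
Qed.

Lemma vol_children x : vol mu (children x) = mu x.
Proof. by rewrite -massE // -?mu_flow //; exact: finite_children. Qed.

Definition generation n x := [set y | iter n pi y = x].

Definition iter_trapezoid h1 h2 x :=
  [set y | exists2 n, (h1 <= n < h2)%N & iter n pi y = x].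

Lemma childP x (z : fset_set (children x)) : pi (val z) = x.
Proof.
have := fsvalP z; rewrite in_fset_set; last exact: finite_children.
by move/set_mem.
Qed.

Lemma generation_partition n x :
  partition_by (fun z : fset_set (children x) => generation n (val z))
    (generation n.+1 x).
Proof.
split; last by move=> z z' _ _ [y [e1 e2]]; apply: val_inj; exact: etrans (esym e1) e2.
apply/seteqP; split=> [y yx|y [z _ yz]]; last first.
  by rewrite /generation /= yz childP.
have yC : iter n pi y \in fset_set (children x).
  by rewrite in_fset_set ?mem_set //; exact: finite_children.
by exists [` yC]%fset.
Qed.

Lemma generation0 x : generation 0 x = [set x].
Proof. by apply/seteqP; split=> y /=. Qed.

Lemma finite_generation n x : finite_set (generation n x).
Proof.
elim: n x => [|n IH] x; first by rewrite generation0.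
by have [-> _] := generation_partition n x; apply: bigcup_finite.
Qed.

Lemma vol_generation n x : vol mu (generation n x) = mu x.
Proof.
elim: n x => [|n IH] x; first by rewrite generation0 vol1.
rewrite (vol_partition mu (finite_generation n.+1 x) (generation_partition n x)).
under eq_bigr do rewrite IH.
by rewrite -[RHS]vol_children /vol big_seq_fsetE.
Qed.

Lemma mu_generation n x y : generation n x y -> mu x <= D ^+ n * mu y.
Proof.
elim: n x => [|n IH] x; first by move=> <-; rewrite mul1r.
move=> <-; apply: le_trans (mu_pi _) _.
by rewrite exprS -mulrA ler_pM2l // IH.
Qed.

Lemma trapezoid_by_generation h1 h2 x :
  partition_by (fun i : 'I_(h2 - h1) => generation (h1 + i)%N x)
    (iter_trapezoid h1 h2 x).
Proof.
split; last first.
  by move=> i j _ _ [y [<- /pi_free/addnI/esym]]; exact: val_inj.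
apply/seteqP; split=> [y [n /andP[h1n nh2] yx]|y [i _ yx]]; last first.
  by exists (h1 + i)%N => //; have := ltn_ord i; lia.
have H : (n - h1 < h2 - h1)%N by lia.
by exists (Ordinal H) => //=; rewrite subnKC.
Qed.

Lemma finite_trapezoid h1 h2 x : finite_set (iter_trapezoid h1 h2 x).
Proof.
have [-> _] := trapezoid_by_generation h1 h2 x.
by apply: bigcup_finite => // i _; exact: finite_generation.
Qed.

Lemma vol_trapezoid h1 h2 x :
  vol mu (iter_trapezoid h1 h2 x) = (h2 - h1)%:R * mu x.
Proof.
rewrite (vol_partition mu (finite_trapezoid h1 h2 x) (trapezoid_by_generation h1 h2 x)).
under eq_bigr do rewrite vol_generation.
by rewrite sumr_const card_ord mulr_natl.
Qed.

Lemma trapezoid_nonempty h1 h2 x : (h1 < h2)%N -> iter_trapezoid h1 h2 x !=set0.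
Proof.
move=> h12; apply/set0P/eqP => E; have := vol_trapezoid h1 h2 x.
rewrite E /vol fset_set0 big_seq_fset0 => /esym/eqP.
by rewrite mulf_eq0 pnatr_eq0 (gt_eqF (mu_gt0 x)) orbF subn_eq0 leqNgt h12.
Qed.

Lemma trapezoid_vertical h1 h2 x :
  partition_by (fun z : fset_set (children x) => iter_trapezoid h1 h2 (val z))
    (iter_trapezoid h1.+1 h2.+1 x).
Proof.
split.
  apply/seteqP; split=> [y [[//|n] n12 yx]|y [z _ [n n12 yz]]]; last first.
    by exists n.+1 => //=; rewrite yz childP.
  have yC : iter n pi y \in fset_set (children x).
    by rewrite in_fset_set ?mem_set //; exact: finite_children.
  by exists [` yC]%fset => //; exists n.
move=> z z' _ _ [y [[n _ yz] [m _ yz']]]; apply: val_inj.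
suff nm : n = m by rewrite -yz -yz' nm.
have /pi_free[] // : iter n.+1 pi y = iter m.+1 pi y.
by rewrite /= yz yz' !childP.
Qed.

Lemma trapezoid_horizontal h1 h h2 x : (h1 <= h <= h2)%N ->
  partition_by (fun b => if b then iter_trapezoid h1 h x else iter_trapezoid h h2 x)
    (iter_trapezoid h1 h2 x).
Proof.
move=> hh; split.
  apply/seteqP; split=> [y [n nh yx]|y [[] _ [n nh yx]]].
  - by have [lt|ge] := ltnP n h; [exists true => //|exists false => //];
      exists n => //; lia.
  - by exists n => //; lia.
  - by exists n => //; lia.
move=> b b' _ _ [y]; case: b; case: b' => //= -[[n nh yx] [m mh ymx]];
  have nm : n = m by [apply: (pi_free (y := y)); rewrite yx ymx];
  by exfalso; move: nh mh; rewrite nm; lia.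
Qed.

Variable beta : R.
Hypothesis beta_ge : 12 <= beta.

(** The number [2 * h2 - h1] decreases both when a trapezoid is cut at an
intermediate height and when one passes to the successors of its root. *)
Definition ranked_trapezoids n : set (set T) :=
  [set E | (exists x, E = [set x]) \/
    exists x h1 h2, [/\ admissible beta h1 h2, E = iter_trapezoid h1 h2 x
                      & n = (2 * h2 - h1)%N]].

(** With [B >= beta]: cutting at a height loses a factor at most [B], passing to a
successor a factor at most [D], and going down fewer than [B] generations to a
single point a factor at most [B * D ^+ B]. *)
Definition ratio : R :=
  let B := (Num.truncn beta).+1 in (B%:R * D ^+ B)^-1.

Lemma ratio01 : 0 < ratio <= 1.
Proof.
have D1 n : 1 <= D ^+ n by rewrite exprn_ege1.
rewrite invr_gt0 invf_le1 mulr_gt0 ?ltr0n ?exprn_gt0 //=.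
by rewrite -[leLHS]mulr1 ler_pM // ler1n.
Qed.

Lemma ranked_finite n E : ranked_trapezoids n E -> finite_set E /\ E !=set0.
Proof.
case=> [[x ->]|[x [h1 [h2 [[_ h12 _ _] -> _]]]]].
  by split; [exact: finite_set1|exists x].
by split; [exact: finite_trapezoid|exact: trapezoid_nonempty].
Qed.

(** Cutting at height [2 * h1] keeps both ratios of heights at least 2 when
[4 * h1 <= h2]. Otherwise passing to the successors raises the ratio of the
heights, but for [h1 >= 2] only to at most 6, which is below [beta]. *)
Lemma ranked_split n E : ranked_trapezoids n E -> (exists x, E = [set x]) \/
  exists (I : finType) (F : I -> set T),
    [/\ partition_by F E,
        forall i, exists2 m, (m < n)%N & ranked_trapezoids m (F i)
      & forall i, ratio * vol mu E <= vol mu (F i)].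
Proof.
case=> [|[x [h1 [h2 [/admissibleP[h10 h12 hb] -> ->]]]]]; [by left|right].
have finE := finite_trapezoid h1 h2 x.
pose B := (Num.truncn beta).+1.
have betaB : beta <= B%:R by rewrite ltW // truncnS_gt.
have B2 : (2 : R) <= B%:R by apply: le_trans betaB; have := beta_ge; lra.
have D1 k : 1 <= D ^+ k by rewrite exprn_ege1.
have c0 : 0 < B%:R * D ^+ B by rewrite mulr_gt0 ?exprn_gt0 ?ltr0n.
have [h1E|h1N] := eqVneq h1 1%N.
  subst h1.
  exists (fset_set (iter_trapezoid 1 h2 x)), (fun z => [set val z]); split.
  - exact: partition_by_singletons.
  - by move=> z; exists 0%N; [lia|left; exists (val z)].
  - move=> z; rewrite vol1 vol_trapezoid /ratio ler_pdivrMl // -mulrA.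
    have /set_mem[k /andP[_ kh] zx] : val z \in iter_trapezoid 1 h2 x.
      by rewrite -in_fset_set // fsvalP.
    have h2B : (h2 <= B)%N.
      rewrite -(ler_nat R); apply: le_trans betaB; apply: le_trans hb _.
      by rewrite mulr1.
    apply: ler_pM; rewrite ?ler0n ?(ltW (mu_gt0 x)) // ?ler_nat; first by lia.
    apply: le_trans (mu_generation zx) _; rewrite ler_pM2r ?mu_gt0 //.
    by apply: ler_weXn2l => //; lia.
have [big|small] := leqP (4 * h1) h2.
  exists bool, (fun b => if b then iter_trapezoid h1 (2 * h1) x
                         else iter_trapezoid (2 * h1) h2 x); split.
  - by apply: trapezoid_horizontal; lia.
  - case; [exists (2 * (2 * h1) - h1)%N|exists (2 * h2 - 2 * h1)%N]; try lia.
      right; exists x, h1, (2 * h1)%N; split=> //; apply/admissibleP; split=> //.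
      rewrite natrM ler_pM2r ?ltr0n //; have := beta_ge; lra.
    right; exists x, (2 * h1)%N, h2; split=> //; apply/admissibleP; split; try lia.
    apply: (le_trans hb); rewrite ler_pM2l ?ler_nat; [lia|by have := beta_ge; lra].
  - have bnd (a : R) : 0 <= a -> (h2 - h1)%:R <= B%:R * a ->
        ratio * vol mu (iter_trapezoid h1 h2 x) <= a * mu x.
      move=> a0 ha; rewrite vol_trapezoid /ratio ler_pdivrMl // mulrA.
      rewrite ler_pM2r ?mu_gt0 //; apply: le_trans ha _.
      by rewrite ler_wpM2r // ler_peMr // ler0n.
    case; rewrite [leRHS]vol_trapezoid; apply: bnd; rewrite ?ler0n //.
      have -> : (2 * h1 - h1 = h1)%N by lia.
      apply: (@le_trans _ _ h2%:R); first by rewrite ler_nat leq_subr.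
      by apply: le_trans hb _; rewrite ler_wpM2r ?ler0n.
    apply: (@le_trans _ _ (2 * (h2 - 2 * h1)%:R)); last by rewrite ler_wpM2r.
    by rewrite -natrM ler_nat; lia.
case: h1 h10 h1N h12 hb small finE => [//|h1] _ h1N h12 hb small finE.
case: h2 h12 hb small finE => [|h2] h12 hb small finE; first by lia.
exists (fset_set (children x)), (fun z => iter_trapezoid h1 h2 (val z)); split.
- exact: trapezoid_vertical.
- move=> z; exists (2 * h2 - h1)%N; first by lia.
  right; exists (val z), h1, h2; split=> //; apply/admissibleP; split; try lia.
  apply: (@le_trans _ _ (12 * h1%:R)); last by rewrite ler_wpM2r.
  by rewrite -natrM ler_nat; lia.
- move=> z; rewrite !vol_trapezoid subSS /ratio ler_pdivrMl // mulrCA.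
  rewrite ler_wpM2l //; apply: le_trans (_ : D * mu (val z) <= _).
    by rewrite -{1}(childP z).
  rewrite ler_pM2r ?mu_gt0 // exprS mulrCA ler_peMr ?(ltW D_gt0) //.
  by rewrite -[leLHS]mulr1 ler_pM // ?ler1n.
Qed.

End Trapezoids.

(** * Exponential averages and the A_p product *)

Section Means.
Variables (R : realType) (T : choiceType) (mu : T -> R) (E : set T).
Hypotheses (mu_gt0 : weight mu) (finE : finite_set E) (E0 : E !=set0).
Implicit Types f g : T -> R.

Let vol0 : 0 < vol mu E. Proof. exact: vol_gt0. Qed.

Lemma meanD f g : mean mu (fun y => f y + g y) E = mean mu f E + mean mu g E.
Proof. by rewrite !meanE // wsumD mulrDr. Qed.

Lemma meanZ a f : mean mu (fun y => a * f y) E = a * mean mu f E.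
Proof. by rewrite !meanE // wsumZ mulrCA. Qed.

Lemma mean_cst a : mean mu (fun=> a) E = a.
Proof. by rewrite meanE // wsum_cst mulrCA mulVf ?mulr1 // gt_eqF. Qed.

Lemma le_mean f g : (forall y, f y <= g y) -> mean mu f E <= mean mu g E.
Proof.
by move=> fg; rewrite !meanE // ler_pM2l ?invr_gt0 //; exact: le_wsum.
Qed.

Lemma mean_ge0 f : (forall y, 0 <= f y) -> 0 <= mean mu f E.
Proof. by move=> f0; rewrite -[leLHS](mean_cst 0) le_mean. Qed.

(** Jensen's inequality, from the tangent line of [expR] at 0. *)
Lemma mean_expR_ge1 a f :
  1 <= mean mu (fun y => expR (a * (f y - mean mu f E))) E.
Proof.
apply: (@le_trans _ _ (mean mu (fun y => 1 + a * (f y + - mean mu f E)) E)).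
  by rewrite meanD mean_cst meanZ meanD mean_cst subrr mulr0 addr0.
by apply: le_mean => y; exact: expR_ge1Dx.
Qed.

Definition ap_product p w : R :=
  mean mu w E * mean mu (fun y => w y `^ (- (p - 1)^-1)) E `^ (p - 1).

(** The A_p product is invariant under multiplying the weight by the constant
[expR (- a)]. The factor 1 puts both averages in the form of [mean_expR_ge1]. *)
Lemma ap_product_shift p a f : 1 < p ->
  ap_product p (fun y => expR (f y)) =
  mean mu (fun y => expR (1 * (f y - a))) E *
  mean mu (fun y => expR (- (p - 1)^-1 * (f y - a))) E `^ (p - 1).
Proof.
move=> p1; rewrite /ap_product.
have -> : (fun y => expR (f y)) = (fun y => expR a * expR (1 * (f y - a))).
  by apply/funext => y; rewrite -expRD; congr expR; ring.
have -> : (fun y => expR (f y) `^ - (p - 1)^-1) =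
    (fun y => expR (- (p - 1)^-1 * a) * expR (- (p - 1)^-1 * (f y - a))).
  apply/funext => y; rewrite -expRM -expRD; congr expR; ring.
rewrite !meanZ powRM ?expR_ge0 //; last by apply: mean_ge0 => y; exact: expR_ge0.
rewrite -expRM mulrACA -expRD mulNr mulNr mulrAC mulVf ?mul1r ?subrr ?expR0 ?mul1r //.
by rewrite gt_eqF // subr_gt0.
Qed.

(** [`|t|] is at most [expR t] plus [(p - 1) * expR (- t / (p - 1))], and each of
the two averages is bounded because the other is at least 1. *)
Lemma oscillation_le p g A : 1 < p -> ap_product p (fun y => expR (g y)) <= A ->
  mean mu (fun y => `|g y - mean mu g E|) E <= A + (p - 1) * A `^ (p - 1)^-1.
Proof.
move=> p1; have pp : 0 < p - 1 by rewrite subr_gt0.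
rewrite (ap_product_shift (mean mu g E) g p1).
set X := mean mu _ E; set Y := mean mu _ E.
have X1 : 1 <= X by exact: mean_expR_ge1.
have Y1 : 1 <= Y by exact: mean_expR_ge1.
have Yp1 : 1 <= Y `^ (p - 1) by rewrite -[leLHS](powRr0 Y) ler_powR // ltW.
move=> XYA.
have XA : X <= A by apply: le_trans XYA; rewrite ler_peMr // (le_trans ler01).
have YA : Y <= A `^ (p - 1)^-1.
  have -> : Y = (Y `^ (p - 1)) `^ (p - 1)^-1.
    by rewrite -powRrM mulfV ?gt_eqF // powRr1 // (le_trans ler01).
  apply: ge0_ler_powR; rewrite ?nnegrE ?powR_ge0 ?invr_ge0 ?(ltW pp) //.
    by rewrite (le_trans _ XA) // (le_trans ler01).
  by apply: le_trans XYA; rewrite ler_peMl // powR_ge0.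
apply: le_trans (lerD XA (ler_wpM2l (ltW pp) YA)).
rewrite /X /Y -meanZ -meanD; apply: le_mean => y.
set t := g y - _.
have E1 := expR_ge1Dx (1 * t).
have : (p - 1) * (1 + - (p - 1)^-1 * t) <= (p - 1) * expR (- (p - 1)^-1 * t).
  by rewrite ler_pM2l // expR_ge1Dx.
have -> : (p - 1) * (1 + - (p - 1)^-1 * t) = p - 1 - t.
  by field; rewrite gt_eqF.
have e1 := expR_gt0 (1 * t).
have : 0 < (p - 1) * expR (- (p - 1)^-1 * t) by rewrite mulr_gt0 ?expR_gt0.
case: (ger0P t); lra.
Qed.

Lemma ap_product_expR p f l l1 C : 1 < p -> 0 <= l -> l <= l1 ->
  l <= (p - 1) * l1 ->
  mean mu (fun y => expR (l1 * `|f y - mean mu f E|)) E <= C ->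
  ap_product p (fun y => expR (l * f y)) <= C * C `^ (p - 1).
Proof.
move=> p1 l0 ll1 lpl1 HC; have pp : 0 < p - 1 by rewrite subr_gt0.
have key b : `|b| <= l1 ->
    mean mu (fun y => expR (b * (f y - mean mu f E))) E <= C.
  move=> bl; apply: le_trans HC; apply: le_mean => y; rewrite ler_expR.
  by rewrite (le_trans (ler_norm _)) // normrM ler_wpM2r.
rewrite (ap_product_shift (l * mean mu f E) _ p1).
have e b : (fun y => expR (b * (l * f y - l * mean mu f E))) =
           (fun y => expR (b * l * (f y - mean mu f E))).
  by apply/funext => y; rewrite -mulrBr mulrA.
have q0 b : 0 <= mean mu (fun y => expR (b y)) E.
  by apply: mean_ge0 => y; exact: expR_ge0.
rewrite (e 1) (e (- (p - 1)^-1)); have k1 := key l; have k2 := key (- (p - 1)^-1 * l).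
have C0 : 0 <= C by apply: le_trans HC.
apply: ler_pM; rewrite ?powR_ge0 //.
  by rewrite mul1r k1 // ger0_norm.
apply: ge0_ler_powR; rewrite ?nnegrE ?(ltW pp) //; apply: k2.
by rewrite mulNr normrN ger0_norm ?mulr_ge0 ?invr_ge0 ?(ltW pp) // ler_pdivrMl.
Qed.

End Means.

(** * Logarithms of weights *)

Lemma ereal_sup_lty (R : realType) (I : Type) (A : set I) (F : I -> R) :
  (ereal_sup [set (F i)%:E | i in A] < +oo)%E <->
  exists K : R, forall i, A i -> F i <= K.
Proof.
split=> [|[K FK]]; last first.
  apply: (@le_lt_trans _ _ K%:E); last exact: ltry.
  by apply: ge_ereal_sup => _ [i Ai <-]; rewrite lee_fin FK.
have ub i : A i -> ((F i)%:E <= ereal_sup [set (F i)%:E | i in A])%E.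
  by move=> Ai; apply: ereal_sup_ubound; exists i.
case: (ereal_sup _) ub => [K|//|] ub _.
  by exists K => i Ai; rewrite -lee_fin ub.
by exists 0 => i /ub; rewrite leeNy_eq.
Qed.

Theorem proposition3p10 (R : realType) (T : choiceType) (adj : rel T)
    (tree_adj : is_tree adj) (infT : infinite_set [set: T])
    (om : set (nat -> T)) (om_bd : boundary adj om)
    (o : T) (xs : nat -> T) (xs_om : om xs) (xs0 : xs 0%N = o)
    (mu : T -> R) (mu_flow : flow_measure adj xs mu)
    (mu_dbl : locally_doubling adj mu)
    (beta : R) (beta_ge : 12 <= beta)
    (p : R) (p_gt1 : 1 < p) :
  [/\ forall w : T -> R, Ap adj beta om mu p w ->
        BMO adj beta om mu (fun x => ln (w x)),
      forall f : T -> R, BMO adj beta om mu f ->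
        exists2 lambda0 : R, 0 < lambda0 &
          forall lambda : R, 0 < lambda <= lambda0 ->
            exists2 w : T -> R, Ap adj beta om mu p w &
              f = (fun x => lambda^-1 * ln (w x))
    & BMO adj beta om mu =
        [set g | exists w : T -> R, exists lambda : R,
           Ainfty adj beta om mu w /\ g = (fun x => lambda * ln (w x))]].
Proof.
have [mu_gt0 flow] := mu_flow.
have [pi [piP succE pi_adj]] := parent_map R tree_adj om_bd xs_om.
have pi_free y n m : iter n pi y = iter m pi y -> n = m.
  by move=> e; have [_ en] := (piP y _ n).2 e; have [_ em] := (piP y _ m).2 erefl;
    rewrite -en em.
have [D D1 muD] := neighbour_comparable tree_adj mu_gt0 mu_dbl.
have mu_pi y : mu (pi y) <= D * mu y by exact/muD/pi_adj.
have flow_pi x : (mu x)%:E = mass mu [set y | pi y = x].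
  by rewrite flow succE.
pose fam := ranked_trapezoids pi beta.
have trapE x h1 h2 : trapezoid adj om x h1 h2 = iter_trapezoid pi h1 h2 x.
  apply/seteqP; split=> y.
    by move=> [b h]; exists (dist adj x y) => //; exact/piP.
  by move=> [n h /piP[b e]]; split; rewrite ?e.
have famP E : trapezoids adj beta om E <-> exists n, fam n E.
  split=> [[[x ->]|[x [h1 [h2 [ad ->]]]]]|[n [|[x [h1 [h2 [ad -> _]]]]]]].
  - by exists 0%N; left; exists x.
  - by exists (2 * h2 - h1)%N; right; exists x, h1, h2; rewrite trapE.
  - by left.
  - by right; exists x, h1, h2; rewrite trapE.
have fam_fin := ranked_finite pi_free mu_gt0 flow_pi D1 mu_pi (beta := beta).
have trap_fin E : trapezoids adj beta om E -> finite_set E /\ E !=set0.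
  by move=> /famP[n]; exact: fam_fin.
have part1 q w : 1 < q -> Ap adj beta om mu q w ->
    BMO adj beta om mu (fun x => ln (w x)).
  move=> q1 [w0 /ereal_sup_lty[A wA]]; apply/ereal_sup_lty.
  exists (A + (q - 1) * A `^ (q - 1)^-1) => E trE.
  have [finE E0] := trap_fin E trE.
  apply: oscillation_le => //.
  rewrite (_ : (fun y => expR _) = w); first exact: wA.
  by apply/funext => y; rewrite lnK ?posrE.
have part2 (f : T -> R) : BMO adj beta om mu f ->
    exists2 lambda0 : R, 0 < lambda0 &
      forall lambda : R, 0 < lambda <= lambda0 ->
        exists2 w : T -> R, Ap adj beta om mu p w &
          f = (fun x => lambda^-1 * ln (w x)).
  move=> /ereal_sup_lty[K0 fK]; pose K := Num.max K0 1.
  have K_gt0 : 0 < K by rewrite lt_max ltr01 orbT.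
  have f_bmo n E : fam n E ->
      wsum mu E (fun y => `|f y - mean mu f E|) <= K * vol mu E.
    move=> famE; have [finE E0] := fam_fin _ _ famE.
    rewrite -ler_pdivrMr ?vol_gt0 // mulrC -meanE //.
    by rewrite le_max fK //; apply/famP; exists n.
  have split := ranked_split pi_free mu_gt0 flow_pi D1 mu_pi beta_ge.
  have jn := john_nirenberg mu_gt0 (ratio01 D1 beta) fam_fin split K_gt0 f_bmo.
  have l_gt0 := jn_exponent_gt0 (ratio01 D1 beta) K_gt0.
  set l1 := jn_exponent _ _ in jn l_gt0.
  have pp : 0 < p - 1 by rewrite subr_gt0.
  exists (Num.min l1 ((p - 1) * l1)); first by rewrite lt_min l_gt0 mulr_gt0.
  (* [l] must suit both [f] and its multiple by [- (p - 1)^-1], the exponent of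
     the dual weight. *)
  move=> l; rewrite le_min => /and3P[l0 ll1 lpl1].
  exists (fun x => expR (l * f x)); last first.
    by apply/funext => x; rewrite expRK mulKf // gt_eqF.
  split; first by move=> x; exact: expR_gt0.
  apply/ereal_sup_lty; exists (6 * 6 `^ (p - 1)) => E trE.
  have [finE E0] := trap_fin E trE; have /famP[n famE] := trE.
  apply: (ap_product_expR mu_gt0 finE E0 p_gt1 (ltW l0) ll1 lpl1).
  by rewrite meanE // mulrC ler_pdivrMr ?vol_gt0 // (jn n).
split; [by move=> w; exact: part1|exact: part2|].
apply/seteqP; split=> [f fB|_ [w [l [[q /= q1 wA] ->]]]].
  have [l0 l0_gt0 H] := part2 f fB.
  have [|w wA fE] := H l0; first by rewrite l0_gt0 lexx.
  by exists w, l0^-1; split=> //; exists p.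
have /ereal_sup_lty[K HK] := part1 q w q1 wA.
apply/ereal_sup_lty; exists (`|l| * K) => E trE.
have [finE E0] := trap_fin E trE.
rewrite meanZ // (_ : (fun y => _) =
  fun y => `|l| * `|ln (w y) - mean mu (fun x => ln (w x)) E|); last first.
  by apply/funext => y; rewrite -mulrBr normrM.
by rewrite meanZ // ler_wpM2l // HK.
Qed.
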